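(* If $A$ is a bounded normal operator on $\mathcal{H}$, then for any set of vectors $\mathcal{G}\subset\mathcal{H}$, the system of iterates $\{A^n g\}_{g\in\mathcal{G},\,n\ge 0}$ is not a basis for $\mathcal{H}$.
   Context: $\mathcal{H}$ is an infinite-dimensional separable complex Hilbert space. The system $\{A^n g\}_{g\in\mathcal{G},\,n\ge 0}$ is regarded as a family indexed by the pairs $(g,n)$ with $g\in\mathcal{G}$, $n\in\{0,1,2,\dots\}$. ''Basis'' means Schauder basis with respect to some enumeration of the index set (in particular every Riesz basis is a basis). *)

(* Defs.v *)
From mathcomp Require Import all_boot all_order all_algebra.
From mathcomp Require Import all_classical all_reals all_analysis.
From mathcomp Require Import complex.

Set Implicit Arguments.
Unset Strict Implicit.
Unset Printing Implicit Defensive.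

Import Order.TTheory GRing.Theory Num.Theory.
Import numFieldNormedType.Exports.

Local Open Scope classical_set_scope.
Local Open Scope ring_scope.

(* A complex Hilbert space is a complete normed module over R[i] whose norm
   comes from an inner product (linear in its first argument).  The norm takes
   its values in R[i], hence no square root or embedding of R. *)
Definition norm_of_dot (R : realType) (H : completeNormedModType R[i])
    (dot : {dot H for Num.conj}) : Prop :=
  forall x : H, `|x| ^+ 2 = dot x x.

Definition separable (T : topologicalType) : Prop :=
  exists2 D : set T, countable D & dense D.

Definition finite_dimensional (K : fieldType) (V : lmodType K) : Prop :=
  exists (n : nat) (e : 'I_n -> V),
    forall x : V, exists c : 'I_n -> K, x = \sum_(i < n) c i *: e i.

Definition bounded_operator (K : numFieldType) (V : normedModType K)
    (A : V -> V) : Prop :=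
  exists M : K, forall x : V, `|A x| <= M * `|x|.

Definition is_adjoint (R : realType) (H : completeNormedModType R[i])
    (dot : {dot H for Num.conj}) (A B : H -> H) : Prop :=
  forall x y : H, dot (A x) y = dot x (B y).

(* The adjoint of a bounded operator on a Hilbert space exists, is unique and
   is automatically linear and bounded, so B below is the operator A^*. *)
Definition normal_operator (R : realType) (H : completeNormedModType R[i])
    (dot : {dot H for Num.conj}) (A : H -> H) : Prop :=
  exists2 B : H -> H, is_adjoint dot A B & A \o B = B \o A.

Definition schauder_basis (K : numFieldType) (V : normedModType K)
    (e : nat -> V) : Prop :=
  forall x : V, exists! c : nat -> K,
    series (fun n => c n *: e n) @ \oo --> x.

(* A family is a basis when some enumeration of its index set, without
   repetition, turns it into a Schauder basis.  Enumerations are indexed by all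
   of nat, since a Schauder basis of an infinite-dimensional space is
   infinite. *)
Definition basis_family (K : numFieldType) (V : normedModType K) (I : Type)
    (f : I -> V) : Prop :=
  exists2 sigma : nat -> I, bijective sigma & schauder_basis (f \o sigma).

(* The family is indexed by the pairs (g, n), not by the set of its values, so
   coincidences between iterates count as repetitions. *)
Definition iterates (T : Type) (A : T -> T) (G : set T)
    (p : set_type G * nat) : T :=
  iter p.2 A (set_val p.1).

(* Main.v *)
Require Import Defs.
From mathcomp Require Import all_boot all_order all_algebra.
From mathcomp Require Import all_classical all_reals all_analysis.
From mathcomp Require Import complex.
From mathcomp Require Import ring lra.
Import Order.TTheory GRing.Theory Num.Theory.
Import numFieldNormedType.Exports.
Local Open Scope classical_set_scope.
Local Open Scope ring_scope.

(** Suppose that some enumeration [e] of the iterates [A^n g] is a Schauder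
    basis, with coordinates [c_(g,n)].

    By the theorem of Banach the coordinates are bounded linear functionals.
    Hence the two identities [c_(g,n+1) (A x) = c_(g,n) x] and
    [c_(g,0) (A x) = 0], which are plain when [x] is an iterate, hold for every
    [x]; continuity is what makes this independent of the order of summation,
    since the shift [(g,n) -> (g,n+1)] does not respect the enumeration.

    The first identity makes [A] injective: if [A x = 0], then all coordinates
    of [x] vanish.  For a normal operator this forces the range to be dense: a
    vector [y] orthogonal to the range satisfies
    [<A y, A y> = <y, A^* A y> = <y, A A^* y> = 0], so [A y = 0] and [y = 0].
    By the second identity the bounded functional [c_(g,0)] vanishes on the
    dense range of [A], hence everywhere, whereas it takes the value 1 at [g].

    Two classical results carry the argument: the boundedness of the
    coordinates ([coord_bounded]), derived from the Baire category theorem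
    ([baire_cover]), and the orthogonal projection onto the closure of a
    subspace ([orthogonal_projection]), derived from the parallelogram law. *)

Set Implicit Arguments.
Unset Strict Implicit.
Unset Printing Implicit Defensive.

(** * Norms with real values *)

(** The norm as an element of [R]: the norm [`|x|] is a real number, but lives
    in [R[i]], whose order is only partial. *)
Definition rnorm (R : realType) (V : normedZmodType R[i]) (x : V) : R :=
  complex.Re `|x|.

Section RealNorm.
Variables (R : realType) (V : normedZmodType R[i]).
Implicit Types x y : V.

Lemma rnormE x : (`|x| : R[i]) = (rnorm x)%:C%C.
Proof. by rewrite /rnorm RRe_real// normr_real. Qed.

Lemma rnorm_ltE x (e : R) : (rnorm x < e) = (`|x| < e%:C%C :> R[i]).
Proof. by rewrite rnormE ltcR. Qed.

Lemma rnorm_ge0 x : 0 <= rnorm x.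
Proof. by rewrite -lecR -rnormE normr_ge0. Qed.

Lemma rnorm0 : rnorm (0 : V) = 0.
Proof. by rewrite /rnorm normr0. Qed.

Lemma rnorm_eq0 x : (rnorm x == 0) = (x == 0).
Proof. by rewrite -(normr_eq0 x) rnormE eq_complex /= eqxx andbT. Qed.

Lemma rnorm_gt0 x : (0 < rnorm x) = (x != 0).
Proof. by rewrite lt_def rnorm_ge0 rnorm_eq0 andbT. Qed.

Lemma rnormN x : rnorm (- x) = rnorm x.
Proof. by rewrite /rnorm normrN. Qed.

Lemma rnormB x y : rnorm (x - y) = rnorm (y - x).
Proof. by rewrite -rnormN opprB. Qed.

Lemma rnormD x y : rnorm (x + y) <= rnorm x + rnorm y.
Proof. by rewrite -lecR rmorphD /= -!rnormE ler_normD. Qed.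

Lemma rnorm_leB x y : rnorm (x - y) <= rnorm x + rnorm y.
Proof. by rewrite (le_trans (rnormD _ _))// rnormN. Qed.

Lemma rnorm_tri y x z : rnorm (x - z) <= rnorm (x - y) + rnorm (y - z).
Proof. by rewrite (le_trans _ (rnormD _ _))// addrA subrK. Qed.

Lemma rnorm_lt_eq0 x : (forall e : R, 0 < e -> rnorm x < e) -> x = 0.
Proof.
move=> small; apply/eqP; rewrite -rnorm_eq0; apply: contraT => x0.
by move: (small (rnorm x)); rewrite ltxx; apply; rewrite lt_def x0 rnorm_ge0.
Qed.

End RealNorm.

Section ScaledNorm.
Variables (R : realType) (V : normedModType R[i]).

Lemma rnormZ (a : R[i]) (x : V) : rnorm (a *: x) = rnorm a * rnorm x.
Proof. by apply: (@complexI R); rewrite rmorphM /= -!rnormE normrZ. Qed.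

(** Convergence tested with real tolerances only. *)
Lemma cvg_rnormP (u : nat -> V) (l : V) :
  u @ \oo --> l <->
  forall e : R, 0 < e -> exists N, forall n, (N <= n)%N -> rnorm (u n - l) < e.
Proof.
split.
- move=> /cvgrPdist_lt ul e e0.
  have /ul[N _ uN] : 0 < e%:C%C by rewrite ltcR.
  by exists N => n Nn; rewrite rnormB rnorm_ltE; apply: uN.
- move=> ul; apply/cvgrPdist_lt => e e0.
  have eE := RRe_real (gtr0_real e0).
  have [N uN] : exists N, forall n, (N <= n)%N ->
      rnorm (u n - l) < complex.Re e by apply: ul; rewrite -ltcR eE.
  by exists N => // n /= Nn; rewrite -eE -rnorm_ltE rnormB; apply: uN.
Qed.

End ScaledNorm.

(** Cauchy sequences, tested with real tolerances only. *)
Definition rcauchy (R : realType) (V : normedZmodType R[i]) (u : nat -> V) :=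
  forall e : R, 0 < e -> exists N, forall m n, (N <= m)%N -> (m <= n)%N ->
    rnorm (u m - u n) < e.

Lemma rcauchy_cvg (R : realType) (V : completeNormedModType R[i])
  (u : nat -> V) : rcauchy u ->
  exists l : V, u @ \oo --> l.
Proof.
move=> uC; apply/cvg_ex; apply/cauchy_cvgP/cauchyP => e e0.
have eE := RRe_real (gtr0_real e0).
have [N uN] : exists N, forall m n, (N <= m)%N -> (m <= n)%N ->
    rnorm (u m - u n) < complex.Re e by apply: uC; rewrite -ltcR eE.
exists (u N); exists N => // n /= Nn.
by rewrite -ball_normE /ball_ /= -eE -rnorm_ltE; apply: uN.
Qed.

(** Completeness of the scalars, through real and imaginary parts. *)
Lemma rcauchy_complex (R : realType) (u : nat -> R[i]) : rcauchy u ->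
  exists l : R[i],
    forall e : R, 0 < e ->
      exists N, forall n, (N <= n)%N -> rnorm (u n - l) < e.
Proof.
move=> uC.
have ReIm (z : R[i]) : rnorm z <= `|complex.Re z| + `|complex.Im z|.
  rewrite /rnorm normc_def /= -(ler_pXn2r (n := 2))// ?nnegrE ?sqrtr_ge0//.
  rewrite sqr_sqrtr ?addr_ge0 ?sqr_ge0// sqrrD !real_normK ?num_real//.
  by rewrite lerD2r lerDl mulrn_wge0// mulr_ge0.
have leRe (z : R[i]) : `|complex.Re z| <= rnorm z.
  by rewrite -lecR -rnormE normc_ge_Re.
have leIm (z : R[i]) : `|complex.Im z| <= rnorm z.
  have := leRe (z * 'i%C); rewrite ReiNIm normrN /rnorm normrM.
  by rewrite (_ : `|'i%C| = 1) ?mulr1// normc_def /= expr0n expr1n add0r sqrtr1.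
have real_lim (f : R[i] -> R) : (forall z, `|f z| <= rnorm z) ->
    (forall z w, f (z - w) = f z - f w) ->
    exists l : R, forall e : R, 0 < e ->
      exists N, forall n, (N <= n)%N -> `|f (u n) - l| < e.
  move=> fle fB; have /cvg_ex[l fl] : cvg ((f \o u) @ \oo).
    apply/cauchy_cvgP/cauchyP => e /uC[N uN].
    exists (f (u N)); exists N => // n /= Nn.
    rewrite -ball_normE /ball_ /= -fB.
    by apply: le_lt_trans (fle _) _; apply: uN.
  exists l => e e0; move/cvgrPdist_lt : fl => /(_ e e0)[N _ uN].
  by exists N => n Nn; rewrite distrC; apply: uN.
have [a ua] := real_lim _ leRe (fun z w => raddfB (@complex.Re R) z w).
have [b ub] := real_lim _ leIm (fun z w => raddfB (@complex.Im R) z w).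
exists (a +i* b)%C => e e0.
have e2 : 0 < e / 2 by lra.
have [N1 uN1] := ua _ e2; have [N2 uN2] := ub _ e2.
exists (maxn N1 N2) => n; rewrite geq_max => /andP[n1 n2].
apply: le_lt_trans (ReIm _) _.
have -> : e = e / 2 + e / 2 by lra.
have -> : complex.Re (u n - (a +i* b)%C) = complex.Re (u n) - a by case: (u n).
have -> : complex.Im (u n - (a +i* b)%C) = complex.Im (u n) - b by case: (u n).
by apply: ltrD; [apply: uN1 | apply: uN2].
Qed.

(** * The Baire category theorem *)

Lemma expr_half_small (R : realType) (K e : R) : 0 < e ->
  exists N, forall n, (N <= n)%N -> K * 2^-1 ^+ n < e.
Proof.
move=> e0; have [K0|K0] := leP K 0.
  by exists 0%N => n _; apply: le_lt_trans e0; rewrite mulr_le0_ge0.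
have := @cvg_geometric R 1 2^-1.
rewrite ger0_norm// invf_lt1// ltr1n => /(_ isT)/cvgrPdist_lt.
move=> /(_ _ (divr_gt0 e0 K0))[N _ hN]; exists N => n /hN /=.
rewrite sub0r normrN mul1r ger0_norm ?exprn_ge0 ?invr_ge0//.
by rewrite ltr_pdivlMr// mulrC.
Qed.

(** If countably many sets cover a complete space, then one of them is dense in
    some ball. *)
Lemma baire_cover (R : realType) (V : completeNormedModType R[i])
    (F : nat -> set V) : (forall x, exists M, F M x) ->
  exists M y (r : R), 0 < r /\ forall z, rnorm (z - y) < r ->
    forall e : R, 0 < e -> exists2 a, F M a & rnorm (z - a) < e.
Proof.
move=> covF; apply: contrapT => noball.
have step (p : nat * (V * R)) : exists q : V * R, 0 < p.2.2 ->
    [/\ 0 < q.2, q.2 <= p.2.2 / 2 & forall w, rnorm (w - q.1) <= q.2 ->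
        rnorm (w - p.2.1) <= p.2.2 /\ ~ F p.1 w].
  case: p => M [y r] /=; have [r0|] := ltP 0 r; last by exists (y, r).
  apply: contrapT => nostep; apply: noball; exists M, y, r; split=> // z zy.
  move=> e e0; apply: contrapT => noa; apply: nostep.
  exists (z, Num.min (r / 2) (Num.min (e / 2) (r - rnorm (z - y)))) => _ /=.
  split.
  - by rewrite !lt_min subr_gt0 zy andbT !divr_gt0.
  - by rewrite ge_min lexx.
  - move=> w; rewrite !le_min => /and3P[_ wz2 wz3]; split.
      by apply: le_trans (rnorm_tri z _ _) _; rewrite -lerBrDr.
    move=> Fw; apply: noa; exists w => //.
    by rewrite rnormB; apply: le_lt_trans wz2 _; lra.
have [f fP] := boolp.choice step.
(* nested balls, given by centre and radius, the [n.+1]-st one avoiding [F n] *)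
pose p := fix p n := if n is m.+1 then f (m, p m) else (0, 1 : R).
have p0 n : 0 < (p n).2.
  by elim: n => [|n IH] //=; have [] := fP (n, p n) IH.
have pS n : (p n.+1).2 <= (p n).2 / 2 by have [] := fP (n, p n) (p0 n).
have pF n w : rnorm (w - (p n.+1).1) <= (p n.+1).2 ->
    rnorm (w - (p n).1) <= (p n).2 /\ ~ F n w.
  by have [_ _ fF] := fP (n, p n) (p0 n) => /fF.
have plt n : (p n).2 <= 2^-1 ^+ n.
  elim: n => [|n IH]; first by rewrite expr0.
  by rewrite exprS; have := pS n; lra.
have nested m n w : (m <= n)%N -> rnorm (w - (p n).1) <= (p n).2 ->
    rnorm (w - (p m).1) <= (p m).2.
  move=> mn; rewrite -(subnKC mn); elim: (n - m)%N => [|k IH]; rewrite ?addn0//.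
  by rewrite addnS => /pF[/IH].
have pp m n : (m <= n)%N -> rnorm ((p n).1 - (p m).1) <= (p m).2.
  by move=> mn; apply: (nested _ n) => //; rewrite subrr rnorm0 ltW.
have [l pl] : exists l : V, (fun n => (p n).1) @ \oo --> l.
  apply: rcauchy_cvg => e e0; have [N hN] := expr_half_small 1 e0.
  exists N => m n Nm mn; rewrite rnormB.
  apply: le_lt_trans (pp _ _ mn) _; apply: le_lt_trans (plt _) _.
  by rewrite -[X in X < _]mul1r hN.
have lp m : rnorm (l - (p m).1) <= (p m).2.
  apply/ler_addgt0Pr => e e0; have [N hN] := (cvg_rnormP _ _).1 pl e e0.
  apply: le_trans (rnorm_tri (p (maxn m N)).1 _ _) _.
  rewrite addrC lerD ?pp ?leq_maxl// rnormB ltW// hN// leq_maxr//.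
by have [M FM] := covF l; have [_ []] := pF M l (lp M.+1).
Qed.

(** * Coordinates of a Schauder basis are bounded *)

Section Schauder.
Variables (R : realType) (V : completeNormedModType R[i]) (e : nat -> V).
Variable c : V -> nat -> R[i].
Hypothesis c_sum : forall x, series (fun n => c x n *: e n) @ \oo --> x.
Hypothesis c_uniq :
  forall x d, series (fun n => d n *: e n) @ \oo --> x -> d = c x.

(* [P n] is the [n]-th partial sum operator *)
Let P n x := \sum_(0 <= k < n) c x k *: e k.

Lemma coord_linear a x y n : c (a *: x + y) n = a * c x n + c y n.
Proof.
rewrite -(c_uniq (d := fun n => a * c x n + c y n))//.
rewrite (_ : series _ = (a \*: series (fun n => c x n *: e n)) \+
    series (fun n => c y n *: e n)); last first.
  apply/funext => m; rewrite /series /= scaler_sumr -big_split /=.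
  by apply: eq_bigr => i _; rewrite scalerDl scalerA.
by apply: cvgD; [apply: cvgZr; apply: c_sum|apply: c_sum].
Qed.

Lemma coord0 n : c 0 n = 0.
Proof.
by have := coord_linear (-1) 0 0 n; rewrite scaler0 addr0 mulN1r addNr.
Qed.

Lemma coordZ a x n : c (a *: x) n = a * c x n.
Proof. by rewrite -[a *: x]addr0 coord_linear coord0 addr0. Qed.

Lemma coordB x y n : c (x - y) n = c x n - c y n.
Proof. by rewrite addrC -scaleN1r coord_linear mulN1r addrC. Qed.

Lemma coord_basis m n : c (e m) n = (n == m)%:R.
Proof.
rewrite -(c_uniq (d := fun n => (n == m)%:R))//; apply/cvg_rnormP => r r0.
exists m.+1 => k mk; rewrite /series /= big_mkord (bigD1 (Ordinal mk)) //= eqxx.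
rewrite scale1r big1 ?addr0 ?subrr ?rnorm0// => i im.
by rewrite (_ : (i == m :> nat) = false) ?scale0r//; apply: contraNF im.
Qed.

Lemma coord_eq0 x : (forall n, c x n = 0) -> x = 0.
Proof.
move=> cx; apply: rnorm_lt_eq0 => r /((cvg_rnormP _ _).1 (@c_sum x))[N].
move=> /(_ N (leqnn N)); rewrite /series /= big1 => [|i _].
  by rewrite sub0r rnormN.
by rewrite cx scale0r.
Qed.

Let basis_neq0 n : e n != 0.
Proof.
apply/eqP => e0; have := coord_basis n n; rewrite e0 coord0 eqxx.
by move/esym/eqP; rewrite oner_eq0.
Qed.

Let PZ n a x : P n (a *: x) = a *: P n x.
Proof.
by rewrite scaler_sumr; apply: eq_bigr => i _; rewrite coordZ scalerA.
Qed.

Let PB n x y : P n (x - y) = P n x - P n y.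
Proof. by rewrite -sumrB; apply: eq_bigr => i _; rewrite coordB scalerBl. Qed.

Let P_pointwise x : exists M : nat, forall n, rnorm (P n x) <= M%:R.
Proof.
have [N hN] := (cvg_rnormP _ _).1 (@c_sum x) _ ltr01.
pose B := rnorm x + 1 + \sum_(j < N) rnorm (P j x).
have sum0 : 0 <= \sum_(j < N) rnorm (P j x).
  by apply: sumr_ge0 => i _; apply: rnorm_ge0.
have [M BM] : exists M : nat, B < M%:R.
  by exists (Num.bound B); apply: archi_boundP; rewrite !addr_ge0 ?rnorm_ge0.
exists M => n; apply: le_trans (ltW BM); rewrite /B.
have x0 := rnorm_ge0 x.
have [nN|Nn] := ltnP n N.
  rewrite (bigD1 (Ordinal nN)) //=.
  have : 0 <= \sum_(i < N | i != Ordinal nN) rnorm (P i x).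
    by apply: sumr_ge0 => i _; apply: rnorm_ge0.
  lra.
have := hN _ Nn; have := rnorm_tri x (P n x) 0; rewrite !subr0 /P /series /=.
lra.
Qed.

(** Baire category: every vector is approximated by vectors whose partial sums
    are controlled by the norm of the vector approximated. *)
Let P_approx : exists C : R, 0 <= C /\ forall z (r : R), 0 < r ->
  exists a, rnorm (z - a) < r /\ forall n, rnorm (P n a) <= C * rnorm z.
Proof.
have [M [y [r [r0 ball]]]] := baire_cover P_pointwise.
exists (4 * M%:R / r); split; first by rewrite divr_ge0 ?mulr_ge0// ltW.
move=> z d d0; have [->|z0] := eqVneq z 0.
  exists 0; rewrite subrr rnorm0; split=> // n.
  by rewrite /P big1 ?rnorm0 ?mulr0// => i _; rewrite coord0 scale0r.
have nz : 0 < rnorm z by rewrite rnorm_gt0.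
(* [t] brings [z] to norm [r / 2], so that [y + t z] lies in the ball *)
pose t := r / (2 * rnorm z).
have t0 : 0 < t by rewrite divr_gt0// mulr_gt0.
have nC (s : R) : 0 < s -> rnorm (s%:C%C : R[i]) = s.
  by move=> s0; rewrite /rnorm ger0_norm// lecR ltW.
have td : 0 < t * d / 2 by rewrite divr_gt0// mulr_gt0.
have [|a1 F1 a1z] := ball (y + t%:C%C *: z) _ _ td.
  rewrite addrC addKr rnormZ nC// /t invfM mulrA mulfVK ?gt_eqF//; lra.
have [|a2 F2 a2z] := ball y _ _ td; first by rewrite subrr rnorm0.
have tu : (t%:C%C : R[i]) != 0 by rewrite gt_eqF// ltcR.
have tV : rnorm ((t^-1)%:C%C : R[i]) = t^-1 by rewrite nC// invr_gt0.
exists ((t^-1)%:C%C *: (a1 - a2)); split.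
  have -> : z - (t^-1)%:C%C *: (a1 - a2) =
      (t^-1)%:C%C *: ((y + t%:C%C *: z - a1) - (y - a2)).
    rewrite -[in LHS](scale1r z) -[1](mulVf tu) -fmorphV -scalerA -scalerBr.
    congr (_ *: _); rewrite !opprB [y + _]addrC -!addrA; congr (_ + _).
    by rewrite (addrCA y) (addrCA y) subrr addr0 addrC.
  rewrite rnormZ tV mulrC ltr_pdivrMr// mulrC.
  by apply: le_lt_trans (rnorm_leB _ _) _; lra.
move=> n; rewrite PZ PB rnormZ tV.
have -> : 4 * M%:R / r * rnorm z = t^-1 * (M%:R + M%:R).
  by rewrite /t invf_div; field; rewrite gt_eqF.
rewrite ler_pM2l ?invr_gt0//; apply: le_trans (rnorm_leB _ _) _.
exact: lerD.
Qed.

(** The partial sums are uniformly bounded: iterating [P_approx] writes [x] as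
    a sum of vectors with geometrically small partial sums.  Adding up their
    coordinates gives an expansion of [x], which is the expansion of [x] by
    uniqueness. *)
Let P_bounded_uniformly : exists C : R, forall x n,
  rnorm (P n x) <= C * rnorm x.
Proof.
have [C0 [C0_ge0 approx]] := P_approx.
exists (2 * C0) => x.
have [->|x0] := eqVneq x 0.
  by move=> n; rewrite /P big1 ?rnorm0 ?mulr0// => i _; rewrite coord0 scale0r.
have q0 : 0 < rnorm x by rewrite rnorm_gt0.
set q := rnorm x in q0 *; pose h (k : nat) : R := q * 2^-1 ^+ k.
have h0 k : 0 < h k by rewrite mulr_gt0// exprn_gt0// invr_gt0.
have hS k : h k.+1 = h k / 2 by rewrite /h exprSr mulrA.
have h_small K r : 0 < r -> exists N, forall n, (N <= n)%N -> K * h n < r.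
  move=> r0; have [N hN] := expr_half_small (K * q) r0; exists N => n Nn.
  by rewrite /h mulrA hN.
have /boolp.choice[g gP] (kz : nat * V) : exists a,
    rnorm (kz.2 - a) < h kz.1.+1 /\
    forall n, rnorm (P n a) <= C0 * rnorm kz.2 by apply: approx.
(* [res k] is what remains of [x] after [k] successive approximations *)
pose res := fix res k := if k is l.+1 then res l - g (l, res l) else x.
have res_lt k : rnorm (res k) <= h k.
  case: k => [|k]; first by rewrite /h expr0 mulr1.
  by have [/ltW] := gP (k, res k).
pose y k := x - res k.
have Py n k l : (k <= l)%N ->
    rnorm (P n (y k) - P n (y l)) <= 2 * C0 * (h k - h l).
  move=> kl; rewrite -(subnKC kl); elim: (l - k)%N => [|i IH].
    by rewrite addn0 !subrr rnorm0 mulr0.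
  apply: le_trans (rnorm_tri (P n (y (k + i)%N)) _ _) _.
  have -> : P n (y (k + i)%N) - P n (y (k + i.+1)%N) =
      - P n (g ((k + i)%N, res (k + i)%N)).
    rewrite -PB /y addnS /= -[RHS]scaleN1r -PZ; congr P.
    by rewrite scaleN1r opprB addrC addrA subrK addrAC subrr add0r.
  rewrite rnormN; have [_ /(_ n)] := gP ((k + i)%N, res (k + i)%N).
  have := ler_wpM2l C0_ge0 (res_lt (k + i)%N).
  have := hS (k + i)%N; rewrite addnS => /= ->; move: IH.
  move: (rnorm _) (rnorm _) (rnorm _) (h k) (h _) => a b d u v; nra.
have Py_le n k l : (k <= l)%N ->
    rnorm (P n (y k) - P n (y l)) <= 2 * C0 * h k.
  move=> kl; apply: le_trans (Py n _ _ kl) _.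
  by rewrite ler_wpM2l ?mulr_ge0// gerBl ltW.
have /boolp.choice[d dP] (j : nat) : exists l, forall r : R, 0 < r ->
    exists N, forall k, (N <= k)%N -> rnorm (c (y k) j - l) < r.
  apply: rcauchy_complex => r r0.
  have ej : 0 < rnorm (e j) by rewrite rnorm_gt0 basis_neq0.
  have [N hN] := h_small (4 * C0) (r * rnorm (e j)) (mulr_gt0 r0 ej).
  exists N => k l Nk kl; rewrite -(ltr_pM2r ej) -rnormZ scalerBl.
  have PS z : c z j *: e j = P j.+1 z - P j z.
    by rewrite /P big_nat_recr //= addrC addrK.
  rewrite !PS opprB [P j (y l) - _]addrC addrACA [- _ + P j _]addrC.
  rewrite -[X in _ + X]opprB.
  apply: le_lt_trans (rnorm_leB _ _) _; apply: le_lt_trans (hN _ Nk).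
  by have := Py_le j _ _ kl; have := Py_le j.+1 _ _ kl; lra.
pose s n := \sum_(0 <= j < n) d j *: e j.
have sP n r : 0 < r ->
    exists N, forall k, (N <= k)%N -> rnorm (P n (y k) - s n) < r.
  elim: n r => [|n IH] r r0.
    by exists 0%N => k _; rewrite /P /s !big_geq// subrr rnorm0.
  have r2 : 0 < r / 2 by lra.
  have en : 0 < rnorm (e n) by rewrite rnorm_gt0 basis_neq0.
  have [N1 h1] := IH _ r2; have [N2 h2] := dP n _ (divr_gt0 r2 en).
  exists (maxn N1 N2) => k; rewrite geq_max => /andP[/h1 k1 /h2].
  rewrite ltr_pdivlMr// -rnormZ => k2.
  rewrite /P /s !big_nat_recr //= opprD addrACA -scalerBl.
  apply: le_lt_trans (rnormD _ _) _; rewrite -/(P n (y k)) -/(s n); lra.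
have s_le n k : rnorm (s n - P n (y k)) <= 2 * C0 * h k.
  apply/ler_addgt0Pr => r r0; have [N hN] := sP n r r0.
  apply: le_trans (rnorm_tri (P n (y (maxn k N))) _ _) _.
  rewrite addrC lerD//; first by rewrite rnormB Py_le// leq_maxl.
  by rewrite rnormB ltW// hN// leq_maxr.
have dc : d = c x.
  apply: c_uniq; apply/cvg_rnormP => r r0.
  have r2 : 0 < r / 2 by lra.
  have [k hk] := h_small (2 * C0 + 1) _ r2.
  have [N hN] := (cvg_rnormP _ _).1 (@c_sum (y k)) _ r2.
  exists N => n /hN Pn.
  apply: le_lt_trans (rnorm_tri (P n (y k)) _ _) _.
  have := rnorm_tri (y k) (P n (y k)) x.
  have -> : y k - x = - res k by rewrite /y addrC addKr.
  rewrite rnormN; have := s_le n k; have := res_lt k; have := hk _ (leqnn k).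
  move: Pn; rewrite /series /= -/(P n (y k)) -/(s n); lra.
move=> n; have := s_le n 0%N; rewrite /s dc -/(P n x).
have -> : y 0%N = 0 by rewrite /y subrr.
rewrite [P n 0]big1 => [|i _]; last by rewrite coord0 scale0r.
by rewrite subr0 /h expr0 mulr1.
Qed.

Lemma coord_bounded j : exists C : R, forall x, rnorm (c x j) <= C * rnorm x.
Proof.
have [C PC] := P_bounded_uniformly.
have ej : 0 < rnorm (e j) by rewrite rnorm_gt0 basis_neq0.
exists (2 * C / rnorm (e j)) => x.
rewrite mulrAC ler_pdivlMr// -rnormZ.
have -> : c x j *: e j = P j.+1 x - P j x.
  by rewrite /P big_nat_recr //= addrC addrK.
apply: le_trans (rnorm_leB _ _) _.
by have := PC x j; have := PC x j.+1; lra.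
Qed.

(** A bounded linear functional that vanishes on the basis is zero. *)
Lemma functional_eq0 (phi : V -> R[i]) (C : R) :
  (forall a x y, phi (a *: x + y) = a * phi x + phi y) ->
  (forall x, rnorm (phi x) <= C * rnorm x) ->
  (forall k, phi (e k) = 0) -> forall x, phi x = 0.
Proof.
move=> phiP phiC phie x.
have phi0 : phi 0 = 0.
  by have := phiP (-1) 0 0; rewrite scaler0 addr0 mulN1r addNr.
have phiS n : phi (P n x) = 0.
  rewrite /P; elim: n => [|n IH]; first by rewrite big_geq.
  by rewrite big_nat_recr //= addrC phiP phie IH mulr0 addr0.
apply: rnorm_lt_eq0 => r r0.
have C1 : 0 < `|C| + 1 by rewrite ltr_wpDl.
have [N /(_ N (leqnn N))] := (cvg_rnormP _ _).1 (@c_sum x) _ (divr_gt0 r0 C1).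
rewrite /series /= -/(P N x) ltr_pdivlMr// => PN.
have -> : phi x = - phi (P N x - x).
  by rewrite addrC -[- x]scaleN1r phiP phiS addr0 mulN1r opprK.
rewrite rnormN; apply: le_lt_trans PN; apply: le_trans (phiC _) _.
rewrite mulrC ler_wpM2l ?rnorm_ge0//.
by apply: le_trans (ler_norm _) _; rewrite lerDl.
Qed.

End Schauder.

(** * Orthogonal projection *)

Section Projection.
Variables (R : realType) (H : completeNormedModType R[i]).
Variable dot : {dot H for Num.conj}.
Hypothesis Hdot : norm_of_dot dot.

Lemma rnorm_sqr (x : H) : ((rnorm x ^+ 2)%:C)%C = dot x x.
Proof. by rewrite rmorphXn /= -rnormE Hdot. Qed.

Lemma rnorm_parallelogram (x y : H) :
  rnorm (x + y) ^+ 2 + rnorm (x - y) ^+ 2 = 2 * (rnorm x ^+ 2 + rnorm y ^+ 2).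
Proof.
apply: (@complexI R); rewrite rmorphM !rmorphD /= !rnorm_sqr.
rewrite dnormD dnormB; ring.
Qed.

(** A vector that cannot be shortened along [v] is orthogonal to [v]: test
    with the projection coefficient of [y] along [v]. *)
Lemma nearest_orthogonal (y v : H) :
  (forall a : R[i], rnorm y <= rnorm (y - a *: v)) -> dot y v = 0.
Proof.
move=> near; have [->|v0] := eqVneq v 0; first exact: linear0r.
have dv : 0 < dot v v by rewrite dnorm_gt0.
have [a aE] : exists a, a * dot v v = dot y v.
  by exists (dot y v / dot v v); rewrite divfK ?gt_eqF.
have := near a.
rewrite -(ler_pXn2r (n := 2)) ?nnegrE ?rnorm_ge0// -lecR !rnorm_sqr dnormB.
rewrite dnormZ linearZr_LR /= rmorphM /= conjCK.
have -> : a^* * dot y v = `|a| ^+ 2 * dot v v.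
  by rewrite -aE mulrA [a^* * a]mulrC -normCK.
have -> : a * (dot y v)^* = `|a| ^+ 2 * dot v v.
  by rewrite -aE rmorphM /= (CrealP (gtr0_real dv)) mulrA -normCK.
set t := _ * _ => le_t; have : t <= 0.
  by move: le_t; rewrite opprD addrA addrK lerBrDr gerDl.
rewrite /t pmulr_lle0// => an; have : `|a| ^+ 2 == 0.
  by rewrite eq_le an exprn_ge0.
by rewrite expf_eq0 /= normr_eq0 => /eqP a0; rewrite -aE a0 mul0r.
Qed.

(** Any [g] is the sum of a vector [y] orthogonal to the subspace [S] and of a
    limit of vectors of [S].  The subspace need not be closed. *)
Lemma orthogonal_projection (S : set H) (g : H) : S 0 ->
    (forall a u v, S u -> S v -> S (a *: u + v)) ->
  exists y, (forall v, S v -> dot y v = 0) /\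
    forall r : R, 0 < r -> exists2 v, S v & rnorm (g - v - y) < r.
Proof.
move=> S0 Slin.
pose D := [set rnorm (g - v) | v in S].
have D_inf : has_inf D.
  split; first by exists (rnorm (g - 0)), 0.
  by exists 0 => _ [v _ <-]; apply: rnorm_ge0.
pose d := inf D.
have d_le v : S v -> d <= rnorm (g - v).
  by move=> Sv; apply: ge_inf; [case: D_inf | exists v].
have d0 : 0 <= d.
  apply: lb_le_inf; first by case: D_inf.
  by move=> _ [v _ <-]; apply: rnorm_ge0.
have h0 (n : nat) : 0 < (2^-1 : R) ^+ n by rewrite exprn_gt0// invr_gt0.
have /boolp.choice[v vP] (n : nat) :
    exists v, S v /\ rnorm (g - v) < d + 2^-1 ^+ n.
  have [_ [v Sv <-] lt_v] := inf_adherent (h0 n) D_inf.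
  by exists v.
pose w n := g - v n.
(* parallelogram law, the midpoint of [w m] and [w n] having norm at least
   [d]; the bound uses [2^-m <= 1] *)
have w_near m n : (m <= n)%N ->
    rnorm (w m - w n) ^+ 2 <= (8 * d + 4) * 2^-1 ^+ m.
  move=> mn.
  have mid : 2 * d <= rnorm (w m + w n).
    have -> : w m + w n = (2%:R : R[i]) *: (g - 2^-1 *: (v m + v n)).
      rewrite scalerBr scalerA mulfV ?pnatr_eq0// scale1r scaler_nat.
      by rewrite /w addrACA mulr2n opprD.
    rewrite rnormZ; have -> : rnorm (2%:R : R[i]) = 2.
      by rewrite /rnorm ger0_norm ?ler0n//= raddfMn.
    rewrite ler_pM2l//; apply: d_le; have [Sm _] := vP m; have [Sn _] := vP n.
    have := Slin 2^-1 (v m + v n) 0.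
    rewrite addr0; apply => //.
    by have := Slin 1 _ _ Sm Sn; rewrite scale1r.
  have := rnorm_parallelogram (w m) (w n).
  have [_ +] := vP m; have [_ +] := vP n; rewrite -!/(w _).
  have hnm : (2^-1 : R) ^+ n <= 2^-1 ^+ m.
    by rewrite ler_wiXn2l// ?invr_ge0// invf_le1// ler1n.
  have hm1 : (2^-1 : R) ^+ m <= 1.
    by rewrite exprn_ile1// ?invr_ge0// invf_le1// ler1n.
  have := rnorm_ge0 (w m); have := rnorm_ge0 (w n); have := h0 m.
  move: mid hnm hm1.
  move: (rnorm (w m)) (rnorm (w n)) (rnorm (w m + w n)) (rnorm (w m - w n)).
  move: (_ ^+ m) (_ ^+ n) => x y a b p q p2d yx x1 x0 b0 a0 b1 a1 eq_pq.
  have a2 : a ^+ 2 <= (d + x) ^+ 2 by rewrite ler_pXn2r ?nnegrE//; lra.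
  have b2 : b ^+ 2 <= (d + x) ^+ 2 by rewrite ler_pXn2r ?nnegrE//; lra.
  have p2 : (2 * d) ^+ 2 <= p ^+ 2 by rewrite ler_pXn2r ?nnegrE//; lra.
  have : x * x <= x by rewrite ger_pMl.
  nra.
have [y wy] : exists y : H, w @ \oo --> y.
  apply: rcauchy_cvg => r r0.
  have [N hN] := expr_half_small (8 * d + 4) (exprn_gt0 2 r0).
  exists N => m n Nm mn.
  rewrite -(ltr_pXn2r (n := 2)) ?nnegrE ?rnorm_ge0 ?ltW//.
  by apply: le_lt_trans (w_near _ _ mn) _; apply: hN.
have w_cvg := (cvg_rnormP _ _).1 wy.
exists y; split=> [u Su|r r0].
  apply: nearest_orthogonal => a; apply/ler_addgt0Pr => r r0.
  have r3 : 0 < r / 3 by lra.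
  have [N1 /(_ (maxn _ _) (leq_maxl _ _)) h1] := w_cvg _ r3.
  have [N2 /(_ (maxn _ _) (leq_maxr _ _)) h2] := expr_half_small 1 r3.
  have := h1 N2; have := h2 N1; set n := maxn N1 N2; rewrite mul1r => hn wn.
  have [Sn +] := vP n; rewrite -/(w n) => wn_lt.
  have : d <= rnorm (w n - a *: u).
    have -> : w n - a *: u = g - (a *: u + v n).
      by rewrite /w opprD addrA addrAC.
    exact/d_le/Slin.
  have : rnorm (w n - a *: u) <= rnorm (w n - y) + rnorm (y - a *: u).
    exact: rnorm_tri.
  have : rnorm (y - 0) <= rnorm (y - w n) + rnorm (w n - 0).
    exact: rnorm_tri.
  rewrite !subr0 [rnorm (y - w n)]rnormB; lra.
have [N hN] := w_cvg _ r0; exists (v N); first by have [] := vP N.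
exact: hN.
Qed.

End Projection.

(** * Iterates of a normal operator *)

Lemma bounded_operator_rnorm (R : realType) (V : normedModType R[i])
    (A : V -> V) : bounded_operator A ->
  exists C : R, forall x, rnorm (A x) <= C * rnorm x.
Proof.
move=> [M AM]; exists (complex.Re M) => x; have := AM x.
rewrite !rnormE lecE => /andP[_]; case: M {AM} => a b /=.
by rewrite mulr0 subr0.
Qed.

Unset Implicit Arguments.

Theorem corollary4p2 (R : realType) (H : completeNormedModType R[i])
    (dot : {dot H for Num.conj}) (Hdot : norm_of_dot dot)
    (Hinf : ~ finite_dimensional H) (Hsep : separable H)
    (A : {linear H -> H}) (Abounded : bounded_operator A)
    (Anormal : normal_operator dot A) (G : set H) :
  ~ basis_family (iterates A (G := G)).
Proof.
move=> [sigma [tau sigmaK tauK] basis].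
set e := _ \o sigma in basis.
have [c c_sum c_uniq] : exists2 c : H -> nat -> R[i],
    forall x, series (fun n => c x n *: e n) @ \oo --> x &
    forall x d, series (fun n => d n *: e n) @ \oo --> x -> d = c x.
  have /boolp.choice[c cP] x := basis x.
  by exists c => [x|x d dx]; [have [] := cP x | have [_ /(_ d dx)] := cP x].
have cB := coord_linear c_sum c_uniq.
have [K AK] := bounded_operator_rnorm Abounded.
have Ae k : A (e k) = e (tau ((sigma k).1, (sigma k).2.+1)).
  by rewrite /e /= tauK.
(* two bounded linear functionals of [x], compared on the basis *)
have c_shift g n x : c (A x) (tau (g, n.+1)) = c x (tau (g, n)).
  have [C1 hC1] := coord_bounded c_sum c_uniq (tau (g, n.+1)).
  have [C2 hC2] := coord_bounded c_sum c_uniq (tau (g, n)).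
  apply/eqP; rewrite -subr_eq0; apply/eqP; move: x.
  apply: (functional_eq0 c_sum (C := `|C1| * K + C2)) => [a x y|x|k].
  - by rewrite linearP !cB; ring.
  - apply: le_trans (rnorm_leB _ _) _; rewrite mulrDl lerD//.
    apply: le_trans (hC1 _) _; rewrite -mulrA.
    apply: le_trans (ler_wpM2r (rnorm_ge0 _) (ler_norm _)) _.
    by rewrite ler_wpM2l.
  - rewrite Ae !(coord_basis c_uniq).
    apply/eqP; rewrite subr_eq0; apply/eqP; congr (nat_of_bool _)%:R.
    rewrite (can_eq tauK) -[k in RHS]sigmaK (can_eq tauK).
    by case: (sigma k) => g' n'; rewrite !xpair_eqE eqSS.
have c_range g x : c (A x) (tau (g, 0%N)) = 0.
  have [C hC] := coord_bounded c_sum c_uniq (tau (g, 0%N)).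
  move: x; apply: (functional_eq0 c_sum (C := `|C| * K)) => [a x y|x|k].
  - by rewrite linearP cB.
  - apply: le_trans (hC _) _; rewrite -mulrA.
    apply: le_trans (ler_wpM2r (rnorm_ge0 _) (ler_norm _)) _.
    by rewrite ler_wpM2l.
  - by rewrite Ae (coord_basis c_uniq) (can_eq tauK) xpair_eqE andbF.
have A_inj x : A x = 0 -> x = 0.
  move=> Ax; apply: (coord_eq0 c_sum) => n; rewrite -[n]sigmaK.
  by case: (sigma n) => g k; rewrite -c_shift Ax (coord0 c_sum c_uniq).
have [y [y_orth y_near]] : exists y : H,
    (forall v, range A v -> dot y v = 0) /\
    forall r : R, 0 < r -> exists2 v, range A v &
      rnorm (e (tau ((sigma 0%N).1, 0%N)) - v - y) < r.
  apply: (orthogonal_projection Hdot) => [|a _ _ [u _ <-] [v _ <-]].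
    by exists 0 => //; rewrite linear0.
  by exists (a *: u + v) => //; rewrite linearP.
have y0 : y = 0.
  (* [<A y, A y> = <y, B (A y)> = <y, A (B y)>], with [A (B y)] in the range *)
  have [B AB ABC] := Anormal; apply: A_inj; apply/eqP.
  rewrite -(dnorm_eq0 dot) AB; have /= <- := congr1 (@^~ y) ABC.
  by apply/eqP/y_orth; exists (B y).
have [C hC] := coord_bounded c_sum c_uniq (tau ((sigma 0%N).1, 0%N)).
have C1 : 0 < `|C| + 1 by rewrite ltr_wpDl.
(* the coordinate is 1 at the vector approximated and 0 at [A x] *)
have [|_ [x _ <-]] := y_near (`|C| + 1)^-1; first by rewrite invr_gt0.
rewrite y0 subr0 -[_^-1]mul1r ltr_pdivlMr// => small.
have := hC (e (tau ((sigma 0%N).1, 0%N)) - A x).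
rewrite (coordB c_sum c_uniq) c_range (coord_basis c_uniq) eqxx subr0.
have -> : rnorm (1 : R[i]) = 1 by rewrite /rnorm normr1.
apply/negP; rewrite -ltNge; apply: le_lt_trans small.
rewrite mulrC ler_wpM2l ?rnorm_ge0//.
by apply: le_trans (ler_norm _) _; rewrite lerDl.
Qed.
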